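(* Let $p\ge0$ and let $u^h(t)$, with $u^h(t)\in\mathcal{V}_h^p$ for any fixed $t$, be the solution to the semi-discrete DoD stabilized problem $$(d_tu^h(t),w^h)_{L^2(\Omega)}+a_h(u^h(t),w^h)+J_h(u^h(t),w^h)=0\qquad\forall\,w^h\in\mathcal{V}_h^p$$ on the cut cell model mesh $\mathcal{M}_h$, for the scalar conservation law $u_t+f(u)_x=0$ in $\Omega\times(0,T)$ with periodic boundary conditions (mesh, $\mathcal{V}_h^p$, $a_h$ and $J_h$ as defined in the context). Let the numerical flux $\mathcal{H}:\mathbb{R}\times\mathbb{R}\to\mathbb{R}$ satisfy: (1) (consistency) $\mathcal{H}(u,u)=f(u)$ for all $u$; (2) (continuity) $\mathcal{H}(u^-,u^+)$ is at least Lipschitz continuous with respect to both arguments; (3) (monotonicity) $\mathcal{H}(u^-,u^+)$ is a non-decreasing function of its first argument $u^-$ and a non-increasing function of its second argument $u^+$. Then the solution satisfies, for all $t\in(0,T)$, $$\|u^h(t)\|_{L^2(\Omega)}\le\|u^h(0)\|_{L^2(\Omega)}.$$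
   Context: **Mesh.** $\Omega=(x_L,x_R)$ is divided into $N$ cells $I_j=(x_{j-\frac12},x_{j+\frac12})$, $j=1,\dots,N$, of equal length $h=(x_R-x_L)/N$. One cell $I_k$ in the interior of the domain ($1<k<N$) is split at $x_{\text{cut}}=x_{k-\frac12}+\alpha h$ into two cut cells $I_{k_1}=(x_{k-\frac12},x_{\text{cut}})$ and $I_{k_2}=(x_{\text{cut}},x_{k+\frac12})$ of lengths $\alpha h$ and $(1-\alpha)h$, with $\alpha\in(0,\frac12]$. The resulting mesh is $\mathcal{M}_h$. Put $\mathcal{I}_{\text{all}}=\{1\le j\le N: j\ne k\}\cup\{k_1,k_2\}$ and $\mathcal{I}_{\mathcal{N}}=\{k-1,k_1,k_2\}$. **Space and notation.** $\mathcal{V}_h^p=\{v^h\in L^2(\Omega): v^h|_{I_j}\in P^p(I_j)\ \forall j\in\mathcal{I}_{\text{all}}\}$, with $P^p$ the polynomials of degree (at most) $p$. For $v^h\in\mathcal{V}_h^p$ and $j\in\mathcal{I}_{\text{all}}$, $v_j$ denotes the polynomial $v^h|_{I_j}$ extended to all of $\Omega$ by evaluating the same polynomial also outside $I_j$. Jumps: $[[w^h]]_{j+\frac12}=w^h(x_{j+\frac12}^-)-w^h(x_{j+\frac12}^+)$ at interior edges, $[[w^h]]_{\text{cut}}=w^h(x_{\text{cut}}^-)-w^h(x_{\text{cut}}^+)$, $[[w^h]]_{\frac12}=-w^h(x_{\frac12}^+)$, $[[w^h]]_{N+\frac12}=w^h(x_{N+\frac12}^-)$. $\mathcal{H}(u_i,u_j)(x)$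 means $\mathcal{H}(u_i(x),u_j(x))$. $\mathcal{H}_a$, $\mathcal{H}_b$ denote the derivatives of $\mathcal{H}$ with respect to its first and second argument. **Unstabilized form.** $$a_h(u^h,w^h)=-\sum_{j\in\mathcal{I}_{\text{all}}}\int_{I_j}f(u^h)\,\partial_xw^h\,dx+\sum_{j=0}^N\mathcal{H}(u_j,u_{j+1})(x_{j+\frac12})[[w^h]]_{j+\frac12}+\mathcal{H}(u_{k_1},u_{k_2})(x_{\text{cut}})[[w^h]]_{\text{cut}},$$ where in the edge sum the cell to the right of $x_{k-\frac12}$ is $I_{k_1}$ and the cell to the left of $x_{k+\frac12}$ is $I_{k_2}$. Periodic boundary conditions mean $u_0(x_{\frac12})=u_N(x_{N+\frac12})$ and $u_{N+1}(x_{N+\frac12})=u_1(x_{\frac12})$. **Stabilization.** $J_h=J_h^{0,k_1}+J_h^{1,k_1}$ with $$J_h^{0,k_1}(u^h,w^h)=\eta_{k_1}\big[\mathcal{H}(u_{k-1},u_{k_2})(x_{k-\frac12})-\mathcal{H}(u_{k-1},u_{k_1})(x_{k-\frac12})\big][[w^h]]_{k-\frac12}+\eta_{k_1}\big[\mathcal{H}(u_{k-1},u_{k_2})(x_{\text{cut}})-\mathcal{H}(u_{k_1},u_{k_2})(x_{\text{cut}})\big][[w^h]]_{\text{cut}},$$ $$J_h^{1,k_1}(u^h,w^h)=\eta_{k_1}\sum_{j\in\mathcal{I}_{\mathcal{N}}}K(j)\int_{I_{k_1}}\big(\mathcal{H}(u_{k-1},u_{k_2})-f(u_j)\big)\partial_xw_j\,dx+\eta_{k_1}\sum_{j\in\mathcal{I}_{\mathcal{N}}}K(j)\int_{I_{k_1}}\mathcal{H}_a(u_{k-1},u_{k_2})\,u_j\,\partial_xw_{k-1}\,dx+\eta_{k_1}\sum_{j\in\mathcal{I}_{\mathcal{N}}}K(j)\int_{I_{k_1}}\mathcal{H}_b(u_{k-1},u_{k_2})\,u_j\,\partial_xw_{k_2}\,dx.$$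 Here $K(k-1)=L_{k_1}$, $K(k_1)=-1$, $K(k_2)=R_{k_1}$. For linear advection $f(u)=\beta u$, $(L_{k_1},R_{k_1})=(1,0)$, $(\frac12,\frac12)$, $(0,1)$ if $\beta>0$, $\beta=0$, $\beta<0$, respectively. For non-linear scalar problems, $(L_{k_1},R_{k_1})=(1,0)$, $(\frac12,\frac12)$, $(0,1)$ if $\hat u>0$, $\hat u=0$, $\hat u<0$, respectively, where $\hat u=\frac12(u_{k-1}(x_{k_1})+u_{k_2}(x_{k_1}))$ and $x_{k_1}$ is the midpoint of $I_{k_1}$. The penalty parameter is $\eta_{k_1}=\max(1-\frac{\alpha}{\nu},0)$ with CFL parameter $\nu>0$. **Conventions.** A solution is a map $t\mapsto u^h(t)\in\mathcal{V}_h^p$, continuous on $[0,T)$ and differentiable on $(0,T)$, satisfying the semi-discrete equation for all $t\in(0,T)$. The flux $\mathcal{H}$ is assumed differentiable a.e. in the sense needed for $J_h^{1,k_1}$: for the solution considered and each $t$, $\mathcal{H}$ is differentiable at $(u_{k-1}(x),u_{k_2}(x))$ for almost every $x\in I_{k_1}$. *)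

(* Defs.v *)
From mathcomp Require Export all_boot all_order all_algebra.
From mathcomp Require Export all_classical all_reals all_analysis.

Set Implicit Arguments.
Unset Strict Implicit.
Unset Printing Implicit Defensive.

Export Order.TTheory GRing.Theory Num.Theory.
Export numFieldNormedType.Exports.

#[global] Open Scope classical_set_scope.
#[global] Open Scope ring_scope.

(* The background cells are numbered 1, ..., ncells as usual; cutidx is the
   index k of the cell that is split. *)
Record cut_mesh (R : realType) := CutMesh {
  xL : R;
  xR : R;
  ncells : nat;
  cutidx : nat;
  alpha : R;
  xL_lt_xR : xL < xR;
  cutidx_interior : (1 < cutidx < ncells)%N;
  alpha_range : 0 < alpha <= 2^-1
}.

(* Labels of the cells of the cut mesh.  Only the labels listed in cells M
   below are meaningful, i.e. [Cell j] with 1 <= j <= ncells M and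
   j != cutidx M. *)
Inductive cell := Cell of nat | Cut1 | Cut2.

(* V_h^p is represented by coefficients: row i of the matrix contains the
   coefficients, with respect to the monomials 1, x, ..., x^p, of the polynomial
   on the i-th cell, the ncells + 1 cells being enumerated from left to right
   starting at 0.  This identifies V_h^p with a finite-dimensional normed module,
   so that continuity and differentiability in time are those of the library. *)
Notation dgspace M p := 'M[_]_((ncells M).+1, p.+1).

Section Mesh.
Variables (R : realType) (M : cut_mesh R).
Local Notation N := (ncells M).
Local Notation k := (cutidx M).

Definition cellwidth : R := (xR M - xL M) / N%:R.

(* edge j is x_{j+1/2} *)
Definition edge (j : nat) : R := xL M + j%:R * cellwidth.

Definition xcut : R := edge k.-1 + alpha M * cellwidth.

Definition Omega : set R := `]xL M, xR M[.

Definition cell_set (c : cell) : set R :=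
  match c with
  | Cell j => `]edge j.-1, edge j[
  | Cut1 => `]edge k.-1, xcut[
  | Cut2 => `]xcut, edge k[
  end.

(* The index set I_all. *)
Definition cells : seq cell :=
  [seq Cell j | j <- iota 1 N & j != k] ++ [:: Cut1; Cut2].

(* The index set I_N. *)
Definition cut_neighbours : seq cell := [:: Cell k.-1; Cut1; Cut2].

(* Position of a cell in the left-to-right enumeration. *)
Definition cell_row (c : cell) : 'I_N.+1 :=
  inord match c with
        | Cell j => if (j < k)%N then j.-1 else j
        | Cut1 => k.-1
        | Cut2 => k
        end.

(* Cells to the left and to the right of x_{j+1/2}. *)
Definition left_cell (j : nat) : cell := if j == k then Cut2 else Cell j.
Definition right_cell (j : nat) : cell :=
  if j.+1 == k then Cut1 else Cell j.+1.

Section Space.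
Variable p : nat.
Implicit Types v w : 'M[R]_(N.+1, p.+1).

(* v_c, as a polynomial on the whole line. *)
Definition piece v (c : cell) : {poly R} := rVpoly (row (cell_row c) v).

(* The function v^h, set to 0 at the finitely many edges and outside Omega. *)
Definition dgfun v (x : R) : R :=
  \sum_(c <- cells) \1_(cell_set c) x * (piece v c).[x].

Definition L2inner v w : R :=
  \int[lebesgue_measure]_(x in Omega) (dgfun v x * dgfun w x).

Definition L2norm v : R := Num.sqrt (L2inner v v).

(* One-sided limits at x_{j+1/2}, with zero exterior values. *)
Definition trace_left w (j : nat) : R :=
  if j == 0%N then 0 else (piece w (left_cell j)).[edge j].
Definition trace_right w (j : nat) : R :=
  if j == N then 0 else (piece w (right_cell j)).[edge j].

(* One-sided limits at x_{j+1/2}, with periodic exterior values. *)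
Definition ptrace_left v (j : nat) : R :=
  if j == 0%N then trace_left v N else trace_left v j.
Definition ptrace_right v (j : nat) : R :=
  if j == N then trace_right v 0 else trace_right v j.

Definition jump w (j : nat) : R := trace_left w j - trace_right w j.
Definition jump_cut w : R := (piece w Cut1).[xcut] - (piece w Cut2).[xcut].

Variables (f : R -> R) (H : R -> R -> R).

(* On the cell c, f(u^h) d_x w^h is f(u_c) (w_c)'. *)
Definition a_h v w : R :=
  - (\sum_(c <- cells)
       \int[lebesgue_measure]_(x in cell_set c)
         (f (piece v c).[x] * (piece w c)^`().[x]))
  + \sum_(0 <= j < N.+1) H (ptrace_left v j) (ptrace_right v j) * jump w j
  + H (piece v Cut1).[xcut] (piece v Cut2).[xcut] * jump_cut w.

Definition Ha (a b : R) : R := derive1 (fun s => H s b) a.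
Definition Hb (a b : R) : R := derive1 (fun s => H a s) b.

Definition uhat v : R :=
  let xmid := (edge k.-1 + xcut) / 2 in
  ((piece v (Cell k.-1)).[xmid] + (piece v Cut2).[xmid]) / 2.

(* The quantity whose sign selects (L_{k_1}, R_{k_1}): the velocity beta = f 1
   for linear advection f(u) = beta u, and uhat for any other flux. *)
Definition wind v : R :=
  if `[< exists beta : R, forall s, f s = beta * s >] then f 1 else uhat v.

Definition Lcoef v : R :=
  if 0 < wind v then 1 else if wind v == 0 then 2^-1 else 0.
Definition Rcoef v : R :=
  if 0 < wind v then 0 else if wind v == 0 then 2^-1 else 1.

Definition Kcoef v (c : cell) : R :=
  match c with
  | Cell _ => Lcoef v
  | Cut1 => - 1
  | Cut2 => Rcoef v
  end.

Variable nu : R.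

Definition eta : R := Num.max (1 - alpha M / nu) 0.

Definition J0 v w : R :=
  let um := piece v (Cell k.-1) in
  let u1 := piece v Cut1 in
  let u2 := piece v Cut2 in
  let xk := edge k.-1 in
  eta * (H um.[xk] u2.[xk] - H um.[xk] u1.[xk]) * jump w k.-1
  + eta * (H um.[xcut] u2.[xcut] - H u1.[xcut] u2.[xcut]) * jump_cut w.

Definition J1 v w : R :=
  let um := piece v (Cell k.-1) in
  let u2 := piece v Cut2 in
  let wm := piece w (Cell k.-1) in
  let w2 := piece w Cut2 in
  eta * (\sum_(c <- cut_neighbours) Kcoef v c *
    \int[lebesgue_measure]_(x in cell_set Cut1)
      ((H um.[x] u2.[x] - f (piece v c).[x]) * (piece w c)^`().[x]))
  + eta * (\sum_(c <- cut_neighbours) Kcoef v c *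
    \int[lebesgue_measure]_(x in cell_set Cut1)
      (Ha um.[x] u2.[x] * (piece v c).[x] * wm^`().[x]))
  + eta * (\sum_(c <- cut_neighbours) Kcoef v c *
    \int[lebesgue_measure]_(x in cell_set Cut1)
      (Hb um.[x] u2.[x] * (piece v c).[x] * w2^`().[x])).

Definition J_h v w : R := J0 v w + J1 v w.

(* Values of u outside [0, T) are irrelevant. *)
Definition DoD_solution (T : R) (u : R -> 'M[R]_(N.+1, p.+1)) : Prop :=
  [/\ {within `[0, T[, continuous u},
      (forall t, 0 < t < T -> derivable u t 1)
    & forall t, 0 < t < T -> forall w,
        L2inner (derive1 u t) w + a_h (u t) w + J_h (u t) w = 0].

Definition flux_ae_differentiable v : Prop :=
  {ae lebesgue_measure, forall x, cell_set Cut1 x ->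
     differentiable (fun z : R * R => H z.1 z.2)
       ((piece v (Cell k.-1)).[x], (piece v Cut2).[x])}.

End Space.
End Mesh.

(* Main.v *)
From HB Require Import structures.
Require Import Defs.
From mathcomp Require Import measurable_realfun zify ring lra.

Set Implicit Arguments.
Unset Strict Implicit.
Unset Printing Implicit Defensive.

(** Testing the scheme with [w = u] gives
    [1/2 d/dt ||u||^2 = - (a_h(u, u) + J_h(u, u))], so everything rests on
    [a_h(v, v) + J_h(v, v) >= 0] ([energy_ge0]); the norm is then a continuous
    function of time with nonpositive derivative.

    Let [g] be an antiderivative of [f] and
    [E(a, b) = H(a, b) (a - b) - g(a) + g(b)], which is the integral of
    [H(a, b) - f(s)] for [s] from [b] to [a].  Monotonicity and consistency of
    [H] make it nonnegative ([dissipation_ge0]).  On a cell [c] the volume term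
    integrates to the difference of [g(v_c)] between the endpoints; regrouping
    these differences by edges turns [a_h(v, v)] into the sum of [E] over all
    edges of the cut mesh ([a_h_energy]), the periodic boundary counting as one
    edge.

    In [J_h(v, v)] write [um, u1, u2] for the extensions to the small cell of
    the pieces of [v] on the left neighbour, the small cell and the right
    neighbour, and [P = L um - u1 + R u2].  The terms with the partial
    derivatives of [H] add up to the integral of [(d/dx H(um, u2)) P], and
    integration by parts cancels the integral of [H(um, u2) P'] found in the
    first sum ([flux_by_parts]).  Only values at the two ends [x0 < x1] of the
    small cell are left.  As [L + R = 1], they combine with the edge terms of
    [J_h] so that [J_h] replaces the fraction [eta] of [E(um, u1)(x0)] by
    [eta R E(um, u2)(x0)], and that of [E(u1, u2)(x1)] by
    [eta L E(um, u2)(x1)] ([J_h_energy]).  Since [0 <= eta <= 1], the total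
    remains nonnegative.

    The delicate point is the integration by parts: [H] is only Lipschitz, and
    the integrand is meaningful only almost everywhere.  Discarding a Borel null
    set does not change the integral of any function, measurable or not
    ([integral_setD_null]); off that set the difference quotients of a locally
    Lipschitz function converge boundedly to its derivative, and dominated
    convergence gives the fundamental theorem of calculus ([FTC_ae]). *)

(** * Antiderivatives of continuous functions *)

Section Calculus.
Context {R : realType}.
Notation mu := (@lebesgue_measure R).

Lemma continuous_integrable_cc (f : R -> R) (a b : R) :
  continuous f -> mu.-integrable `[a, b] (EFin \o f).
Proof.
move=> cf; apply: continuous_compact_integrable; first exact: segment_compact.
exact: continuous_subspaceT.
Qed.

Lemma continuous_integrable_oo (f : R -> R) (a b : R) :
  continuous f -> mu.-integrable `]a, b[ (EFin \o f).
Proof.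
move=> cf; apply: integrableS (continuous_integrable_cc a b cf) => //.
exact: subset_itv_oo_cc.
Qed.

Lemma antiderivative_gt (f : R -> R) (c : R) : continuous f ->
  exists g : R -> R, forall x : R, c < x -> is_derive x 1 g (f x).
Proof.
move=> cf; exists (fun x => \int[mu]_(t in `[c, x]) f t) => x cx.
have [|dF F'] := @continuous_FTC1_closed R f c x (x + 1) _
  (continuous_integrable_cc c (x + 1) cf) cx (cf x).
  by rewrite ltrDl.
by apply: DeriveDef; [exact: dF|rewrite -derive1E; exact: F'].
Qed.

(** An integral from a fixed base point is an antiderivative only to the right
    of that point, so the antiderivative on the line is glued from one on
    ]-1, +oo[ and the reflection of another one, which differ by a constant on
    the overlap ]-1, 1[. *)
Lemma antiderivative (f : R -> R) : continuous f ->
  exists g : R -> R, forall x : R, is_derive x 1 g (f x).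
Proof.
move=> cf; have [gp dgp] := antiderivative_gt (-1) cf.
have cfN : continuous (fun x => f (- x)).
  by move=> x; apply: continuous_comp; [exact: opp_continuous|exact: cf].
have [gn dgn] := antiderivative_gt (-1) cfN.
pose gm x := - gn (- x).
have dgm (x : R) : x < 1 -> is_derive x 1 gm (f x).
  move=> x1; rewrite /gm.
  have dN : is_derive x (1 : R) (fun x : R => - x) (-1) by exact: is_deriveN.
  have h := is_derive1_comp (dgn (- x) _) dN.
  have -> : f x = - (-1 * f (- - x)) by rewrite opprK mulN1r opprK.
  rewrite mulrC.
  by apply: is_deriveN; apply: h; rewrite ltrN2.
pose d := gp 0 - gm 0.
have gpm x : -1 < x -> x <= 0 -> gp x = gm x + d.
  move=> xm x0.
  have dd (y : R) : y \in `]x, 0[%R -> is_derive y 1 (gp - gm) 0.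
    rewrite in_itv /= => /andP[xy y0].
    have := dgp y (lt_trans xm xy); have := dgm y (lt_trans y0 ltr01).
    by move=> h1 h2; have := is_deriveB h2 h1; rewrite subrr.
  have [|c _] := MVT_segment x0 dd.
    apply: continuous_in_subspaceT => y; rewrite inE /= in_itv /= => /andP[xy y0].
    apply/differentiable_continuous/derivable1_diffP.
    have y1 : y < 1 by rewrite (le_lt_trans y0).
    apply: derivableB; first by have := dgp y (lt_le_trans xm xy); case.
    by have := dgm y y1; case.
  rewrite mul0r => /eqP; rewrite subr_eq0 => /eqP h.
  have : gp 0 - gm 0 = gp x - gm x by [].
  by rewrite /d => ->; rewrite addrC subrK.
exists (fun x => if 0 <= x then gp x else gm x + d) => x.
have [x0|x0] := ltP x 0.
- apply: (@near_eq_is_derive _ _ _ (gm + cst d)).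
    near=> y.
    suff -> : (0 <= y) = false by [].
    by apply/negbTE; rewrite -ltNge; near: y; exact: lt_nbhsl.
  rewrite -[f x]addr0; apply: is_deriveD.
  by apply: dgm; rewrite (lt_trans x0).
- have xm : -1 < x by rewrite (lt_le_trans _ x0)// ltrN10.
  apply: (@near_eq_is_derive _ _ _ gp); last exact: dgp.
  near=> y.
  have [//|y0] := leP 0 y.
  rewrite gpm//; last exact: ltW.
  by near: y; exact: lt_nbhsr.
Unshelve. all: by end_near. Qed.

Lemma is_derive1_continuous (G F : R -> R) :
  (forall x : R, is_derive x 1 G (F x)) -> continuous G.
Proof.
move=> dG x; apply/differentiable_continuous/derivable1_diffP.
by have := dG x; case.
Qed.

Lemma FTC_oo (G F : R -> R) (a b : R) : a <= b ->
  (forall x : R, is_derive x 1 G (F x)) -> continuous F ->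
  \int[mu]_(x in `]a, b[) F x = G b - G a.
Proof.
rewrite le_eqVlt => /predU1P[->|ab] dG cF.
  by rewrite set_itv_ge ?bnd_simp ?ltxx// Rintegral_set0 subrr.
have cG := is_derive1_continuous dG.
rewrite Rintegral_itv_bndo_bndc; last exact: continuous_integrable_oo.
rewrite Rintegral_itv_obnd_cbnd; last first.
  apply: integrableS (continuous_integrable_cc a b cF) => //.
  exact: subset_itv_oc_cc.
rewrite /Rintegral (@continuous_FTC2 R F G)//.
- exact: continuous_subspaceT.
- split.
  + by move=> x _; have := dG x; case.
  + exact/cvg_at_right_filter/cG.
  + exact/cvg_at_left_filter/cG.
- by move=> x _; rewrite derive1E; have := dG x; case.
Qed.

End Calculus.

(** * Integrals and null sets *)

Section NullSets.
Local Open Scope ereal_scope.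
Context d (T : measurableType d) (R : realType).
Variable mu : {measure set T -> \bar R}.
Import HBNNSimple.

(** The integral of a nonnegative function is the supremum over the simple
    functions below it.  These may be set to zero on a null set without changing
    their integral, so the supremum does not see null sets, whether or not [f]
    is measurable. *)
Lemma ge0_integral_setD_null (D A : set T) (f : T -> \bar R) :
  measurable A -> mu A = 0 -> (forall x, D x -> 0 <= f x) ->
  \int[mu]_(x in D) f x = \int[mu]_(x in D `\` A) f x.
Proof.
move=> mA muA f0.
have pD E : (forall x, E x -> 0 <= f x) -> forall x, 0 <= (f \_ E) x.
  by move=> h x; rewrite patchE; case: ifPn => // /set_mem; exact: h.
rewrite integral_mkcond [RHS]integral_mkcond.
rewrite !ge0_integralTE; [|by apply: pD => x [/f0]|exact: pD].
apply/eqP; rewrite eq_le; apply/andP; split.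
- apply: ge_ereal_sup => _ /= [h hf <-].
  pose h' := [the {nnsfun T >-> R} of proj_nnsfun h (measurableC mA)].
  have -> : sintegral mu h = sintegral mu (h' : T -> R).
    transitivity (\int[mu]_x (h x)%:E).
      by rewrite integral_nnsfun// patch_setT.
    transitivity (\int[mu]_x (h' x)%:E); last first.
      by rewrite integral_nnsfun// patch_setT.
    apply: ae_eq_integral => //; [exact/measurable_EFinP/measurable_funTS..|].
    exists A; split => // x /=; apply: contra_notP => nAx _.
    by rewrite mindicE mem_set//= mulr1.
  apply: ereal_sup_ubound; exists h' => //= x.
  rewrite mindicE in_setC; have := hf x; rewrite !patchE in_setD.
  by case: (x \in A); rewrite /= ?andbF ?andbT ?mulr0 ?mulr1.
- apply: le_ereal_sup => _ /= [h hf <-]; exists h => //= x.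
  apply: (le_trans (hf x)); rewrite !patchE in_setD.
  case: (x \in A); rewrite /= ?andbF ?andbT//.
  by case: ifPn => // /set_mem; exact: f0.
Qed.

Lemma integral_setD_null (D A : set T) (f : T -> \bar R) :
  measurable A -> mu A = 0 ->
  \int[mu]_(x in D) f x = \int[mu]_(x in D `\` A) f x.
Proof.
move=> mA muA; rewrite integralE [RHS]integralE.
by rewrite -!(@ge0_integral_setD_null D A).
Qed.

End NullSets.

(** * The fundamental theorem of calculus for Lipschitz functions *)

Section DifferenceQuotients.
Context {R : realType}.
Notation mu := (@lebesgue_measure R).

Definition diffquot (F : R -> R) (n : nat) (x : R) : R :=
  n.+1%:R * (F (x + n.+1%:R^-1) - F x).

Lemma diffquot_cvg (F : R -> R) (x d : R) :
  is_derive x 1 F d -> diffquot F ^~ x @ \oo --> d.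
Proof.
move=> [dF <-].
have hs : @harmonic R @ \oo --> (0 : R)^'.
  move=> A /= [e e0 eA].
  have : \forall n \near \oo, `|@harmonic R n| < e.
    have /cvgr0Pnorm_lt := @cvg_harmonic R; exact.
  apply: filterS => n hn; apply: eA => /=; first by rewrite sub0r normrN.
  by rewrite invr_eq0 pnatr_eq0.
have := cvg_comp _ _ hs dF.
rewrite (_ : (fun h : R => _) \o _ = diffquot F ^~ x)//.
apply/funext => n; rewrite /diffquot /= invrK.
by rewrite /GRing.scale /= mulr1 (addrC x).
Qed.

Lemma continuous_diffquot (F : R -> R) (n : nat) :
  continuous F -> continuous (diffquot F n).
Proof.
move=> cF x; apply: cvgM; first exact: cvg_cst.
apply: cvgB; last exact: cF.
apply: (@continuous_comp _ _ _ (fun y : R => y + n.+1%:R^-1) F); last exact: cF.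
by apply: cvgD; [exact: cvg_id|exact: cvg_cst].
Qed.

(** With [G] an antiderivative of [F], the integral of the difference quotient
    of [F] is the increment of the difference quotient of [G], which tends to
    that of [G' = F]. *)
Lemma integral_diffquot_cvg (F : R -> R) (a b : R) : a <= b -> continuous F ->
  (\int[mu]_(x in `]a, b[) diffquot F n x) @[n --> \oo] --> F b - F a.
Proof.
move=> ab cF; have [G dG] := antiderivative cF.
have dq (n : nat) : \int[mu]_(x in `]a, b[) diffquot F n x =
    diffquot G n b - diffquot G n a.
  apply: FTC_oo => //; last exact: continuous_diffquot.
  move=> x.
  have ds : is_derive x 1 (fun y : R => y + n.+1%:R^-1) 1.
    by rewrite -[X in is_derive _ _ _ X]addr0; apply: is_deriveD.
  have := @is_derive1_comp R G (fun y => y + n.+1%:R^-1) x _ _ (dG _) ds.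
  rewrite mulr1 => dGs.
  exact: (@is_deriveZ _ _ _ _ n.+1%:R _ _ _ (is_deriveB dGs (dG x))).
under eq_fun do rewrite dq.
by apply: cvgB; exact: diffquot_cvg.
Qed.

Lemma measurable_itvD (a b : R) (A : set R) :
  measurable A -> measurable (`]a, b[ `\` A).
Proof. by move=> mA; exact: measurableD. Qed.

Lemma itvD_finite (a b : R) (A : set R) :
  measurable A -> (mu (`]a, b[ `\` A) < +oo)%E.
Proof.
move=> mA; apply: (@le_lt_trans _ _ (mu `]a, b[)).
  by apply: le_measure => //; rewrite ?inE//; exact: measurable_itvD.
by rewrite lebesgue_measure_itv /=; case: ifP => //; rewrite -EFinD ltry.
Qed.

(** Fundamental theorem of calculus for a Lipschitz function differentiable off
    the null set [A].  The integrals of its difference quotients converge both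
    to the increment of [F] and, by dominated convergence, to the integral of
    the derivative.  Only forward increments occur, and they may step out of the
    interval by at most 1. *)
Lemma FTC_ae (F D : R -> R) (a b C : R) (A : set R) :
  a <= b -> continuous F ->
  (forall x e : R, a < x < b -> 0 < e <= 1 -> `|F (x + e) - F x| <= C * e) ->
  measurable A -> mu A = 0%E ->
  (forall x, (`]a, b[ `\` A) x -> is_derive x 1 F (D x)) ->
  \int[mu]_(x in `]a, b[ `\` A) D x = F b - F a.
Proof.
move=> ab cF lipF mA muA dF.
set E := `]a, b[ `\` A.
have mE : measurable E by exact: measurable_itvD.
have mdq n : measurable_fun E (diffquot F n).
  apply: (@measurable_funS _ _ _ _ setT) => //.
  by apply: continuous_measurable_fun; exact: continuous_diffquot.
have dqD x : E x -> diffquot F ^~ x @ \oo --> D x.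
  by move=> /dF; exact: diffquot_cvg.
have mD : measurable_fun E D by exact: measurable_fun_cvg mdq dqD.
have dqC n x : E x -> `|diffquot F n x| <= C.
  move=> [/=]; rewrite in_itv /= => xab _.
  rewrite normrM ger0_norm// mulrC -ler_pdivlMr// lipF//.
  by rewrite invr_gt0 ltr0n /= invf_le1 ?ler1n.
have iC : mu.-integrable E (EFin \o cst C).
  apply: measurable_bounded_integrable => //; first exact: itvD_finite.
  exists `|C|; split; first by rewrite num_real.
  by move=> M ? x _ /=; exact: ltW.
have [||iD _ cvgI] := @dominated_convergence _ _ _ mu E mE
  (fun n => EFin \o diffquot F n) (EFin \o D) (EFin \o cst C)
  (fun n => (measurable_EFinP _ _).2 (mdq n)) ((measurable_EFinP _ _).2 mD)
  _ iC.
- apply: aeW => x Ex; apply/fine_cvgP; split; first exact: nearW.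
  exact: dqD.
- by apply: aeW => x n Ex; exact: dqC.
have fD : (\int[mu]_(x in E) (D x)%:E = (\int[mu]_(x in E) D x)%:E)%E.
  by rewrite /Rintegral fineK//; exact: integrable_fin_num.
have {}cvgI : (\int[mu]_(x in `]a, b[) diffquot F n x) @[n --> \oo] -->
    \int[mu]_(x in E) D x.
  move: cvgI; rewrite fD => /fine_cvgP[_]; apply: cvg_trans.
  apply: near_eq_cvg; apply: nearW => n /=.
  by rewrite /Rintegral [in RHS](@integral_setD_null _ _ _ mu _ A).
exact: cvg_unique cvgI (integral_diffquot_cvg ab cF).
Qed.

End DifferenceQuotients.

(** * Increments and the chain rule *)

Section Increments.
Context {R : realType}.

Lemma continuous_bounded_cc (F : R -> R) (a b : R) : a <= b -> continuous F ->
  exists2 C, 0 <= C & forall x, a <= x <= b -> `|F x| <= C.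
Proof.
move=> ab cF; have cN : continuous (fun x => `|F x|).
  by move=> x; apply: cvg_norm; exact: cF.
have [c _ hc] := EVT_max ab (continuous_subspaceT cN).
by exists `|F c| => // x xab; apply: hc; rewrite in_itv.
Qed.

(** A Lipschitz condition in the form required by [FTC_ae]. *)
Definition increments_bounded (F : R -> R) (a b : R) :=
  exists2 C, 0 <= C & forall x e : R, a < x < b -> 0 < e <= 1 ->
    `|F (x + e) - F x| <= C * e.

Lemma C1_increments_bounded (G F : R -> R) (a b : R) :
  a <= b -> (forall x : R, is_derive x 1 G (F x)) -> continuous F ->
  increments_bounded G a b.
Proof.
move=> ab dG cF; have ab1 : a <= b + 1 by rewrite (le_trans ab)// lerDl.
have [C C0 hC] := continuous_bounded_cc ab1 cF.
exists C => // x e /andP[ax xb] /andP[e0 e1].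
have xe : x < x + e by rewrite ltrDl.
have [|c cI ->] := MVT xe (fun y _ => dG y).
  exact/continuous_subspaceT/is_derive1_continuous.
move: cI; rewrite in_itv /= => /andP[xc cxe].
rewrite addrC addKr normrM (gtr0_norm e0) ler_wpM2r ?(ltW e0)// hC//.
by apply/andP; split; lra.
Qed.

Lemma increments_boundedM (F G : R -> R) (a b : R) : a <= b ->
  continuous F -> continuous G ->
  increments_bounded F a b -> increments_bounded G a b ->
  increments_bounded (fun x => F x * G x) a b.
Proof.
move=> ab cF cG [CF CF0 hF] [CG CG0 hG].
have ab1 : a <= b + 1 by rewrite (le_trans ab)// lerDl.
have [BF BF0 bF] := continuous_bounded_cc ab1 cF.
have [BG BG0 bG] := continuous_bounded_cc ab1 cG.
exists (CF * BG + BF * CG); first by rewrite addr_ge0// mulr_ge0.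
move=> x e xab e01.
rewrite (_ : _ - _ = (F (x + e) - F x) * G (x + e) + F x * (G (x + e) - G x));
  last by ring.
rewrite (le_trans (ler_normD _ _))// [leRHS]mulrDl !normrM lerD//.
- rewrite mulrAC ler_pM ?hF// bG//.
  by case/andP: xab e01 => ? ? /andP[? ?]; apply/andP; split; lra.
- rewrite -mulrA ler_pM ?hG// bF//.
  by case/andP: xab => ? ?; apply/andP; split; lra.
Qed.

End Increments.

Section ChainRule.
Context {R : realType}.

Lemma is_derive_curve (h : R * R -> R) (p q : R -> R) (x p' q' : R) :
  is_derive x 1 p p' -> is_derive x 1 q q' ->
  differentiable h (p x, q x) ->
  is_derive x 1 (fun y => h (p y, q y)) ('d h (p x, q x) (p', q')).
Proof.
move=> [dp <-] [dq <-] dh.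
have dp' : differentiable p x by exact/derivable1_diffP.
have dq' : differentiable q x by exact/derivable1_diffP.
have dpq : differentiable (fun y => (p y, q y)) x by exact: differentiable_pair.
have dF : differentiable (h \o (fun y => (p y, q y))) x.
  exact: differentiable_comp.
apply: DeriveDef; first exact/derivable1_diffP.
rewrite (deriveE _ dF) diff_comp//= diff_pair//=.
by rewrite -!deriveE.
Qed.

Variable H : R -> R -> R.
Let h (z : R * R) := H z.1 z.2.

Lemma is_derive_Ha (a b : R) : differentiable h (a, b) ->
  is_derive a 1 (fun s => H s b) (Ha H a b).
Proof.
move=> dh; have := @is_derive_curve h id (cst b) a _ _ (is_derive_id _ _)
  (is_derive_cst _ _ _) dh.
by rewrite /Ha derive1E => -[dF _]; apply: DeriveDef; [exact: dF|].
Qed.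

Lemma is_derive_Hb (a b : R) : differentiable h (a, b) ->
  is_derive b 1 (fun s => H a s) (Hb H a b).
Proof.
move=> dh; have := @is_derive_curve h (cst a) id b _ _ (is_derive_cst _ _ _)
  (is_derive_id _ _) dh.
by rewrite /Hb derive1E => -[dF _]; apply: DeriveDef; [exact: dF|].
Qed.

(** Differentiability of [H] as a function of two variables is needed here: it
    makes the derivative along the curve [(p, q)] the linear combination of the
    partial derivatives. *)
Lemma is_derive_flux (p q : R -> R) (x p' q' : R) :
  is_derive x 1 p p' -> is_derive x 1 q q' ->
  differentiable h (p x, q x) ->
  is_derive x 1 (fun y => H (p y) (q y))
    (Ha H (p x) (q x) * p' + Hb H (p x) (q x) * q').
Proof.
move=> dp dq dh.
have [_ <-] := is_derive_Ha dh; have [_ <-] := is_derive_Hb dh.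
have [_ ->] := @is_derive_curve h id (cst (q x)) (p x) _ _ (is_derive_id _ _)
  (is_derive_cst _ _ _) dh.
have [_ ->] := @is_derive_curve h (cst (p x)) id (q x) _ _ (is_derive_cst _ _ _)
  (is_derive_id _ _) dh.
have := is_derive_curve dp dq dh.
rewrite (_ : (p', q') = p' *: (1, 0) + q' *: (0, 1)); last first.
  by congr (_, _); rewrite /= scaler0 ?addr0 ?add0r; exact/esym/mulr1.
by rewrite linearD !linearZ /= ![_ *: _]mulrC.
Qed.

End ChainRule.

(** * Integration by parts along a Lipschitz flux *)

Section FluxIntegrals.
Context {R : realType}.
Notation mu := (@lebesgue_measure R).

Definition flux_lipschitz (H : R -> R -> R) (K : R) := forall a a' b b' : R,
  `|H a b - H a' b'| <= K * (`|a - a'| + `|b - b'|).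

Lemma flux_lipschitz_swap (H : R -> R -> R) (K : R) :
  flux_lipschitz H K -> flux_lipschitz (fun a b => H b a) K.
Proof. by move=> hK a a' b b'; rewrite [`|a - _| + _]addrC; exact: hK. Qed.

Lemma continuous_flux (H : R -> R -> R) (K : R) (p q : R -> R) :
  0 <= K -> flux_lipschitz H K -> continuous p -> continuous q ->
  continuous (fun x => H (p x) (q x)).
Proof.
move=> K0 hK cp cq x; apply/cvgrPdist_le => e e0.
(* [K + 1] rather than [K] keeps the denominator positive. *)
have d0 : 0 < e / (2 * (K + 1)) by rewrite divr_gt0// mulr_gt0// ltr_wpDl.
have /cvgrPdist_le/(_ _ d0) np := cp x.
have /cvgrPdist_le/(_ _ d0) nq := cq x.
near=> y.
have py : `|p x - p y| <= e / (2 * (K + 1)) by near: y.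
have qy : `|q x - q y| <= e / (2 * (K + 1)) by near: y.
rewrite (le_trans (hK _ _ _ _))// (le_trans (ler_wpM2l K0 (lerD py qy)))//.
rewrite (_ : K * _ = e * (K / (K + 1))); last first.
  by field; rewrite gt_eqF// ltr_wpDl.
by rewrite ger_pMr// ler_pdivrMr ?mul1r ?lerDl// ltr_wpDl.
Unshelve. all: by end_near. Qed.

Lemma increments_bounded_flux (H : R -> R -> R) (K : R) (p q : R -> R)
    (a b : R) : 0 <= K -> flux_lipschitz H K ->
  increments_bounded p a b -> increments_bounded q a b ->
  increments_bounded (fun x => H (p x) (q x)) a b.
Proof.
move=> K0 hK [Cp Cp0 hp] [Cq Cq0 hq]; exists (K * (Cp + Cq)).
  by rewrite mulr_ge0// addr_ge0.
move=> x e xab e01; rewrite (le_trans (hK _ _ _ _))// -mulrA ler_wpM2l//.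
by rewrite mulrDl lerD ?hp ?hq.
Qed.

Lemma Rintegral_setD_null (D A : set R) (f : R -> R) :
  measurable A -> mu A = 0%E ->
  \int[mu]_(x in D) f x = \int[mu]_(x in D `\` A) f x.
Proof. by move=> mA muA; congr fine; exact: integral_setD_null. Qed.

Variables (a b : R) (A : set R).
Hypotheses (ab : a <= b) (mA : measurable A) (muA : mu A = 0%E).
Let E := `]a, b[ `\` A.

Lemma continuous_integrable_itvD (c : R -> R) :
  continuous c -> mu.-integrable E (EFin \o c).
Proof.
move=> cc; apply: integrableS (continuous_integrable_oo a b cc) => //.
- exact: measurable_itvD.
- exact: subDsetl.
Qed.

(** A partial derivative is a limit of difference quotients of the continuous
    flux, hence measurable and bounded by the Lipschitz constant away from the
    null set where it may fail to exist. *)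
Lemma integrable_partial_derivative (H : R -> R -> R) (K : R)
    (p q D c : R -> R) :
  0 <= K -> flux_lipschitz H K -> continuous p -> continuous q -> continuous c ->
  (forall x, E x -> is_derive (p x) 1 (fun s => H s (q x)) (D x)) ->
  mu.-integrable E (EFin \o (fun x => D x * c x)).
Proof.
move=> K0 hK cp cq cc dH.
pose Q n x := diffquot (fun s => H s (q x)) n (p x).
have mE : measurable E by exact: measurable_itvD.
have mQ n : measurable_fun E (Q n).
  apply: (@measurable_funS _ _ _ _ setT) => //.
  apply: continuous_measurable_fun => x; rewrite /Q /diffquot.
  apply: cvgM; first exact: cvg_cst.
  apply: cvgB; last exact: continuous_flux K0 hK cp cq x.
  apply: (continuous_flux (p := fun x => p x + n.+1%:R^-1) K0 hK _ cq) => y.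
  by apply: cvgD; [exact: cp|exact: cvg_cst].
have QD x : E x -> Q ^~ x @ \oo --> D x by move=> /dH/diffquot_cvg.
have mD : measurable_fun E D by exact: measurable_fun_cvg mQ QD.
have DK x : E x -> `|D x| <= K.
  move=> Ex; have cN : `|Q n x| @[n --> \oo] --> `|D x|.
    by apply: cvg_norm; exact: QD.
  rewrite -(cvg_lim (@Rhausdorff R) cN).
  apply: limr_le; first by apply/cvg_ex; eexists; exact: cN.
  apply: nearW => n; rewrite normrM ger0_norm// mulrC -ler_pdivlMr//.
  rewrite (le_trans (hK _ _ _ _))// subrr normr0 addr0 addrC addKr.
  by rewrite ger0_norm.
have [C C0 hC] := continuous_bounded_cc ab cc.
apply: measurable_bounded_integrable => //; first exact: itvD_finite.
  apply: measurable_funM => //; apply: (@measurable_funS _ _ _ _ setT) => //.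
  exact: continuous_measurable_fun.
exists (K * C); split; first by rewrite num_real.
move=> M hM x Ex; apply: le_trans (ltW hM).
rewrite /= normrM ler_pM//; first exact: DK.
case: Ex => /=; rewrite in_itv /= => /andP[ax xb] _.
by apply: hC; rewrite !ltW.
Qed.

(** The integrands on the left may fail to be measurable; they are integrable
    off the null set [A], which is enough for the integrals to add up. *)
Lemma Rintegral_sum_coef (I : Type) (s : seq I) (k : I -> R) (D : R -> R)
    (U : I -> {poly R}) (r : R -> R) :
  (forall c, continuous c -> mu.-integrable E (EFin \o (fun x => D x * c x))) ->
  continuous r ->
  \sum_(i <- s) k i * \int[mu]_(x in `]a, b[) (D x * (U i).[x] * r x) =
  \int[mu]_(x in `]a, b[) (D x * (\sum_(i <- s) k i *: U i).[x] * r x).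
Proof.
move=> iD cr.
have iU (P : {poly R}) : mu.-integrable E (EFin \o (fun x => D x * P.[x] * r x)).
  have cPr : continuous (fun x => P.[x] * r x).
    by move=> x; apply: cvgM; [exact: continuous_horner|exact: cr].
  rewrite (_ : _ \o _ = EFin \o (fun x => D x * (P.[x] * r x))); first exact: iD.
  by apply/funext => x /=; rewrite mulrA.
have mE : measurable E by exact: measurable_itvD.
elim: s => [|i s ih].
  rewrite !big_nil; apply/esym.
  under eq_Rintegral do rewrite horner0 mulr0 mul0r.
  by rewrite Rintegral_cst// mul0r.
rewrite !big_cons ih !(@Rintegral_setD_null `]a, b[ A _ mA muA) -RintegralZl//.
rewrite -RintegralD//; last first.
  rewrite (_ : _ \o _ = EFin \o (fun x => D x * (k i *: U i).[x] * r x)).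
    exact: iU.
  by apply/funext => x /=; rewrite hornerZ; congr EFin; ring.
apply: eq_Rintegral => x _; rewrite hornerD hornerZ; ring.
Qed.

Section ByParts.
Variables (H : R -> R -> R) (K : R) (p q : {poly R}).
Hypotheses (K0 : 0 <= K) (hK : flux_lipschitz H K).
Hypothesis dH : forall x, E x ->
  differentiable (fun z : R * R => H z.1 z.2) (p.[x], q.[x]).

Lemma integrable_Ha (c : R -> R) : continuous c ->
  mu.-integrable E (EFin \o (fun x => Ha H p.[x] q.[x] * c x)).
Proof.
move=> cc; apply: (@integrable_partial_derivative H K (horner p) (horner q)) => //.
- exact: continuous_horner.
- exact: continuous_horner.
- by move=> x /dH; exact: is_derive_Ha.
Qed.

Lemma integrable_Hb (c : R -> R) : continuous c ->
  mu.-integrable E (EFin \o (fun x => Hb H p.[x] q.[x] * c x)).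
Proof.
move=> cc; apply: (@integrable_partial_derivative (fun a b => H b a) K
    (horner q) (horner p)) => //.
- exact: flux_lipschitz_swap.
- exact: continuous_horner.
- exact: continuous_horner.
- by move=> x /dH; exact: is_derive_Hb.
Qed.

(** Integration by parts for the Lipschitz function x |-> H(p(x), q(x)), whose
    derivative exists only almost everywhere. *)
Lemma flux_by_parts (P : {poly R}) :
  \int[mu]_(x in `]a, b[) (Ha H p.[x] q.[x] * P.[x] * p^`().[x]) +
  \int[mu]_(x in `]a, b[) (Hb H p.[x] q.[x] * P.[x] * q^`().[x]) +
  \int[mu]_(x in `]a, b[) (H p.[x] q.[x] * P^`().[x]) =
  H p.[b] q.[b] * P.[b] - H p.[a] q.[a] * P.[a].
Proof.
have mE : measurable E by exact: measurable_itvD.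
have cH : continuous (fun x => H p.[x] q.[x]).
  exact: continuous_flux K0 hK (@continuous_horner _ _) (@continuous_horner _ _).
have cpoly (r s : {poly R}) : continuous (fun x => r.[x] * s.[x]).
  by move=> x; apply: cvgM; exact: continuous_horner.
have ibp (r : {poly R}) : increments_bounded (horner r) a b.
  exact: C1_increments_bounded ab (is_derive_poly r) (@continuous_horner _ _).
rewrite !(@Rintegral_setD_null `]a, b[ A _ mA muA).
have i1 := integrable_Ha (cpoly P p^`()).
have i2 := integrable_Hb (cpoly P q^`()).
have i3 : mu.-integrable E (EFin \o (fun x => H p.[x] q.[x] * P^`().[x])).
  apply: continuous_integrable_itvD => x; apply: cvgM; first exact: cH.
  exact: continuous_horner.
under eq_Rintegral do rewrite -mulrA.
under [X in _ + X + _ = _]eq_Rintegral do rewrite -mulrA.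
rewrite -RintegralD// -RintegralD//; last first.
  exact: (integrableD _ i1 i2).
have [C C0 hC] : increments_bounded (fun x => H p.[x] q.[x] * P.[x]) a b.
  apply: increments_boundedM => //.
    exact: continuous_horner.
  exact: increments_bounded_flux K0 hK (ibp p) (ibp q).
apply: (@FTC_ae _ (fun x => H p.[x] q.[x] * P.[x]) _ _ _ C) => //.
  by move=> x; apply: cvgM; [exact: cH|exact: continuous_horner].
move=> x /dH dHx.
have dF := is_derive_flux (is_derive_poly p x) (is_derive_poly q x) dHx.
have := is_deriveM dF (is_derive_poly P x).
congr is_derive.
by rewrite /GRing.scale /=; ring.
Qed.

End ByParts.
End FluxIntegrals.

(** * Dissipation of the unstabilized form *)

Section EntropyFlux.
Context {R : realType}.
Variables (f : R -> R) (H : R -> R -> R) (g : R -> R).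
Hypothesis H_consistent : forall s, H s s = f s.
Hypothesis H_mono1 : forall b, {homo (fun a => H a b) : a a' / a <= a'}.
Hypothesis H_mono2 :
  forall a, {homo (fun b => H a b) : b b' / b <= b' >-> b' <= b}.
Hypothesis dg : forall s : R, is_derive s 1 g (f s).

(** The integral of [H a b - f s] for [s] from [b] to [a]: the amount of
    the entropy [s ^ 2 / 2] that the flux [H] dissipates at an edge with traces
    [a] and [b]. *)
Definition dissipation (a b : R) : R := H a b * (a - b) - g a + g b.

(** By the mean value theorem [g a - g b = H c c * (a - b)] for some [c] between
    [a] and [b], and monotonicity of [H] compares [H c c] with [H a b] in the
    direction given by the sign of [a - b]. *)
Lemma dissipation_ge0 (a b : R) : 0 <= dissipation a b.
Proof.
have cg := is_derive1_continuous dg.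
rewrite /dissipation; have [ab|ba] := leP a b.
- have [c] := MVT_segment ab (fun x _ => dg x) (continuous_subspaceT cg).
  rewrite in_itv /= => /andP[ac cb] gE.
  rewrite (_ : _ + _ = (f c - H a b) * (b - a)); last first.
    by rewrite mulrBl -gE; ring.
  rewrite mulr_ge0 ?subr_ge0// -H_consistent (le_trans (H_mono1 b ac))//.
  exact: H_mono2.
- have [c] := MVT_segment (ltW ba) (fun x _ => dg x) (continuous_subspaceT cg).
  rewrite in_itv /= => /andP[bc ca] gE.
  rewrite (_ : _ + _ = (H a b - f c) * (a - b)); last first.
    by rewrite mulrBl -gE; ring.
  rewrite mulr_ge0 ?subr_ge0 ?(ltW ba)// -H_consistent.
  by rewrite (le_trans _ (H_mono1 b ca))//; exact: H_mono2.
Qed.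

Lemma integral_flux_poly (r : {poly R}) (a b : R) :
  continuous f -> a <= b ->
  \int[lebesgue_measure]_(x in `]a, b[) (f r.[x] * r^`().[x]) =
  g r.[b] - g r.[a].
Proof.
move=> cf ab; apply: (@FTC_oo _ (g \o horner r)) => //.
move=> x; apply: cvgM; last exact: continuous_horner.
by apply: continuous_comp; [exact: continuous_horner|exact: cf].
Qed.

End EntropyFlux.

Section Mesh.
Context {R : realType}.
Variable M : cut_mesh R.
Local Notation N := (ncells M).
Local Notation k := (cutidx M).

Lemma cellwidth_gt0 : 0 < cellwidth M.
Proof.
rewrite /cellwidth divr_gt0 ?subr_gt0 ?xL_lt_xR//.
by rewrite ltr0n; have := cutidx_interior M; lia.
Qed.

Lemma le_edge (i j : nat) : (i <= j)%N -> edge M i <= edge M j.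
Proof.
by move=> ij; rewrite lerD2l ler_wpM2r ?ler_nat// ltW// cellwidth_gt0.
Qed.

Lemma edge_le_xcut : edge M k.-1 <= xcut M.
Proof.
rewrite lerDl mulr_ge0 ?(ltW cellwidth_gt0)//.
by case/andP: (alpha_range M) => /ltW.
Qed.

Lemma xcut_le_edge : xcut M <= edge M k.
Proof.
have /andP[_ a2] := alpha_range M.
have k1 : (1 < k)%N by have := cutidx_interior M; lia.
rewrite /xcut /edge -addrA lerD2l -mulrDl ler_wpM2r ?(ltW cellwidth_gt0)//.
rewrite -[in leRHS](prednK (ltnW k1)) -natr1 lerD2l (le_trans a2)//.
by rewrite invf_le1 ?ler1n.
Qed.

Variables (p : nat) (f : R -> R) (H : R -> R -> R) (g : R -> R).
Hypothesis cf : continuous f.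
Hypothesis dg : forall s : R, is_derive s 1 g (f s).
Implicit Types v : 'M[R]_(N.+1, p.+1).
Local Notation dis := (dissipation H g).

(** Summation by parts over the mesh: the differences between cell endpoints
    are regrouped by edges, the cut point being the only edge off the background
    grid. *)
Lemma sum_cells_telescope (G : cell -> R -> R) :
  \sum_(c <- cells M) match c with
    | Cell j => G c (edge M j) - G c (edge M j.-1)
    | Cut1 => G c (xcut M) - G c (edge M k.-1)
    | Cut2 => G c (edge M k) - G c (xcut M) end =
  \sum_(1 <= j < N.+1) G (left_cell M j) (edge M j) -
  \sum_(0 <= j < N) G (right_cell M j) (edge M j) +
  (G Cut1 (xcut M) - G Cut2 (xcut M)).
Proof.
have kN := cutidx_interior M.
have kE : k = k.-1.+1 by lia.
(* Edge [j.+1] is paired with edge [j], the two ends of background cell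
   [j.+1]; the pair with [j.+1 = k] belongs to the two cut cells. *)
have -> : \sum_(1 <= j < N.+1) G (left_cell M j) (edge M j) -
    \sum_(0 <= j < N) G (right_cell M j) (edge M j) =
    \sum_(0 <= j < N) (G (left_cell M j.+1) (edge M j.+1) -
                       G (right_cell M j) (edge M j)).
  by rewrite sumrB big_add1.
rewrite /cells big_cat big_map big_filter /= !big_cons big_nil addr0.
rewrite -[iota 1 N]/(iota 1 N.+1.-1) -[N.+1.-1]subn1 -/(index_iota 1 N.+1).
rewrite big_add1 /= [in RHS](bigD1_seq k.-1) ?iota_uniq ?mem_index_iota//=;
  last by lia.
rewrite /left_cell /right_cell -kE eqxx.
under [in RHS]eq_bigl do rewrite -eqSS -kE.
rewrite [in RHS](eq_bigr (fun j => G (Cell j.+1) (edge M j.+1) -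
    G (Cell j.+1) (edge M j))); last by move=> j /negbTE ->.
ring.
Qed.

Lemma left_cell_neq (j : nat) : j != k -> left_cell M j = Cell j.
Proof. by rewrite /left_cell => /negbTE ->. Qed.

(** Both boundary edges carry the same periodic flux, and each contributes one
    side of the jump between the last and the first cell. *)
Lemma sum_edge_flux v :
  \sum_(0 <= j < N.+1) H (ptrace_left v j) (ptrace_right v j) * jump v j =
  \sum_(1 <= j < N) H (trace_left v j) (trace_right v j) *
                    (trace_left v j - trace_right v j) +
  H (trace_left v N) (trace_right v 0) * (trace_left v N - trace_right v 0).
Proof.
have kN := cutidx_interior M.
have N0 : (N == 0)%N = false by lia.
rewrite big_ltn// big_nat_recr /=; last by lia.
rewrite /jump /ptrace_left /ptrace_right eqxx N0 [0%N == N]eq_sym N0 eqxx /=.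
rewrite (eq_big_nat _ _ (F2 := fun j => H (trace_left v j) (trace_right v j) *
                    (trace_left v j - trace_right v j))); last first.
  move=> j /andP[j1 jN]; rewrite (ltn_eqF jN).
  by case: eqP j1 => // ->.
have -> : trace_left v 0 = 0 by [].
have -> : trace_right v N = 0 by rewrite /trace_right eqxx.
ring.
Qed.

(** Each cell contributes the difference of [g] between its endpoints; grouped
    by edges, these differences complete the edge fluxes to dissipations. *)
Lemma a_h_energy v :
  a_h f H v v =
  \sum_(1 <= j < N) dis (trace_left v j) (trace_right v j) +
  dis (trace_left v N) (trace_right v 0) +
  dis (piece v Cut1).[xcut M] (piece v Cut2).[xcut M].
Proof.
have kN := cutidx_interior M.
rewrite /a_h sum_edge_flux /jump_cut.
have -> : \sum_(c <- cells M) \int[lebesgue_measure]_(x in cell_set M c)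
    (f (piece v c).[x] * (piece v c)^`().[x]) =
    \sum_(c <- cells M) let G c x := g (piece v c).[x] in match c with
    | Cell j => G c (edge M j) - G c (edge M j.-1)
    | Cut1 => G c (xcut M) - G c (edge M k.-1)
    | Cut2 => G c (edge M k) - G c (xcut M) end.
  apply: eq_bigr => -[j||] _; rewrite /= (integral_flux_poly dg)//.
  - exact/le_edge/leq_pred.
  - exact: edge_le_xcut.
  - exact: xcut_le_edge.
rewrite sum_cells_telescope.
have -> : \sum_(1 <= j < N.+1) g (piece v (left_cell M j)).[edge M j] =
    \sum_(1 <= j < N) g (trace_left v j) + g (trace_left v N).
  rewrite big_nat_recr /=; last by lia.
  rewrite /trace_left gtn_eqF; last by lia.
  congr (_ + _); apply: eq_big_nat => j /andP[j1 _].
  by rewrite gtn_eqF.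
have -> : \sum_(0 <= j < N) g (piece v (right_cell M j)).[edge M j] =
    g (trace_right v 0) + \sum_(1 <= j < N) g (trace_right v j).
  rewrite big_ltn; last by lia.
  rewrite /trace_right ltn_eqF; last by lia.
  congr (_ + _); apply: eq_big_nat => j /andP[_ jN].
  by rewrite ltn_eqF.
rewrite /dissipation big_split sumrB /=.
ring.
Qed.

End Mesh.

(** * Dissipation of the stabilized form *)

Section Stabilization.
Context {R : realType}.
Variable M : cut_mesh R.
Local Notation N := (ncells M).
Local Notation k := (cutidx M).
Variables (p : nat) (f : R -> R) (H : R -> R -> R) (g : R -> R) (K nu : R).
Hypotheses (K0 : 0 <= K) (hK : flux_lipschitz H K).
Hypothesis cf : continuous f.
Hypothesis dg : forall s : R, is_derive s 1 g (f s).
Implicit Types v : 'M[R]_(N.+1, p.+1).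
Local Notation dis := (dissipation H g).

Lemma Lcoef_ge0 v : 0 <= Lcoef f v.
Proof. by rewrite /Lcoef; case: ifP => // _; case: ifP. Qed.

Lemma Rcoef_ge0 v : 0 <= Rcoef f v.
Proof. by rewrite /Rcoef; case: ifP => // _; case: ifP. Qed.

Lemma Lcoef_add_Rcoef v : Lcoef f v + Rcoef f v = 1.
Proof.
rewrite /Lcoef /Rcoef; case: ifP => _; first by rewrite addr0.
by case: ifP => _; [field|rewrite add0r].
Qed.

Lemma eta_ge0 : 0 <= eta M nu.
Proof. by rewrite /eta le_max lexx orbT. Qed.

Lemma eta_le1 : 0 < nu -> eta M nu <= 1.
Proof.
move=> nu0; rewrite /eta ge_max ler01 andbT lerBlDr lerDl divr_ge0 ?(ltW nu0)//.
by case/andP: (alpha_range M) => /ltW.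
Qed.

(** The combination [P] of the pieces with coefficients [K] multiplies the
    derivative of [H(um, u2)] in the last two sums, and its derivative
    multiplies [H(um, u2)] in the first, so integration by parts leaves boundary
    values only. *)
Lemma J1_energy v : flux_ae_differentiable H v ->
  let um := piece v (Cell k.-1) in
  let u1 := piece v Cut1 in
  let u2 := piece v Cut2 in
  let Phi x := H um.[x] u2.[x] *
      (Lcoef f v * um.[x] - u1.[x] + Rcoef f v * u2.[x]) -
    (Lcoef f v * g um.[x] - g u1.[x] + Rcoef f v * g u2.[x]) in
  J1 f H nu v v = eta M nu * (Phi (xcut M) - Phi (edge M k.-1)).
Proof.
move=> [A [mA muA dH]] um u1 u2 Phi.
have dHE x : (`]edge M k.-1, xcut M[ `\` A) x ->
    differentiable (fun z : R * R => H z.1 z.2) (um.[x], u2.[x]).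
  move=> [xI nAx]; apply: contrapT => nd; apply: nAx; apply: dH => /= h.
  exact/nd/h.
have ab := edge_le_xcut M.
have cp := @continuous_horner R.
have cH : continuous (fun x => H um.[x] u2.[x]).
  exact: continuous_flux K0 hK (cp _) (cp _).
have iH (c : R -> R) : continuous c -> lebesgue_measure.-integrable
    (`]edge M k.-1, xcut M[ `\` A) (EFin \o (fun x => H um.[x] u2.[x] * c x)).
  move=> cc; apply: continuous_integrable_itvD => // x.
  by apply: cvgM; [exact: cH|exact: cc].
pose P := \sum_(c <- cut_neighbours M) Kcoef f v c *: piece v c.
have PE x : P.[x] = Lcoef f v * um.[x] - u1.[x] + Rcoef f v * u2.[x].
  rewrite /P /cut_neighbours !big_cons big_nil !hornerE /= -/um -/u1 -/u2.
  ring.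
have S1 : \sum_(c <- cut_neighbours M) Kcoef f v c *
    \int[lebesgue_measure]_(x in cell_set M Cut1)
      ((H um.[x] u2.[x] - f (piece v c).[x]) * (piece v c)^`().[x]) =
    \int[lebesgue_measure]_(x in cell_set M Cut1) (H um.[x] u2.[x] * P^`().[x]) -
    \sum_(c <- cut_neighbours M) Kcoef f v c *
      (g (piece v c).[xcut M] - g (piece v c).[edge M k.-1]).
  have -> : \int[lebesgue_measure]_(x in cell_set M Cut1)
      (H um.[x] u2.[x] * P^`().[x]) =
      \sum_(c <- cut_neighbours M) Kcoef f v c *
      \int[lebesgue_measure]_(x in cell_set M Cut1)
        (H um.[x] u2.[x] * (piece v c)^`().[x]).
    (* The derivatives of the pieces play the part of the polynomials, and the
       second factor is 1. *)
    have := @Rintegral_sum_coef R _ _ A mA muA _ (cut_neighbours M)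
      (Kcoef f v) _ (fun c => (piece v c)^`()) (cst 1) iH (@cst_continuous _ _ _).
    under eq_bigr do under eq_Rintegral do rewrite /= mulr1.
    move=> ->; apply: eq_Rintegral => x _.
    rewrite mulr1 /P raddf_sum; congr (_ * _.[x]).
    by apply: eq_bigr => c _; rewrite /= derivZ.
  rewrite -sumrB; apply: eq_bigr => c _; rewrite -mulrBr; congr (_ * _).
  rewrite /cell_set -(integral_flux_poly dg)// -RintegralB//.
  - by apply: eq_Rintegral => x _; rewrite mulrBl.
  - apply: continuous_integrable_oo => x; apply: cvgM; first exact: cH.
    exact: cp.
  - apply: continuous_integrable_oo => x; apply: cvgM; last exact: cp.
    by apply: continuous_comp; [exact: cp|exact: cf].
have regroup (I1 I2 I3 S y : R) : I2 + I3 + I1 = y -> I1 - S + I2 + I3 = y - S.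
  by move=> <-; ring.
rewrite /J1 -/um -/u2 [X in _ * X + _ + _ = _]S1.
rewrite [X in _ + _ * X + _ = _](Rintegral_sum_coef mA muA _ _ _
  (integrable_Ha ab mA K0 hK dHE) (@continuous_horner _ _)).
rewrite [X in _ + _ * X = _](Rintegral_sum_coef mA muA _ _ _
  (integrable_Hb ab mA K0 hK dHE) (@continuous_horner _ _)).
rewrite -/P -!mulrDr; congr (_ * _).
rewrite (regroup _ _ _ _ _ (flux_by_parts ab mA muA K0 hK dHE P)).
rewrite !PE /cut_neighbours !big_cons big_nil /= -/um -/u1 -/u2 /Phi.
ring.
Qed.

(** The stabilization removes a fraction [eta] of the dissipation at both ends
    of the small cell, and adds that of a direct flux between its two
    neighbours, split between the ends by the weights [R] and [L]. *)
Lemma J_h_energy v : flux_ae_differentiable H v ->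
  let um := piece v (Cell k.-1) in
  let u1 := piece v Cut1 in
  let u2 := piece v Cut2 in
  let x0 := edge M k.-1 in
  let x1 := xcut M in
  J_h f H nu v v =
  eta M nu * (Rcoef f v * dis um.[x0] u2.[x0] - dis um.[x0] u1.[x0]) +
  eta M nu * (Lcoef f v * dis um.[x1] u2.[x1] - dis u1.[x1] u2.[x1]).
Proof.
move=> /J1_energy J1E um u1 u2 x0 x1; rewrite /J_h J1E /J0 /jump_cut.
have kN := cutidx_interior M.
have -> : jump v k.-1 = um.[x0] - u1.[x0].
  rewrite /jump /trace_left /trace_right gtn_eqF ?ltn_eqF; [|lia..].
  rewrite left_cell_neq ?ltn_eqF; [|lia..].
  by rewrite /right_cell prednK ?eqxx; last lia.
have -> : Rcoef f v = 1 - Lcoef f v by rewrite -(Lcoef_add_Rcoef v); ring.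
rewrite -/um -/u1 -/u2 -/x0 -/x1 /dissipation; ring.
Qed.

Hypothesis H_consistent : forall s, H s s = f s.
Hypothesis H_mono1 : forall b, {homo (fun a => H a b) : a a' / a <= a'}.
Hypothesis H_mono2 :
  forall a, {homo (fun b => H a b) : b b' / b <= b' >-> b' <= b}.
Hypothesis nu_gt0 : 0 < nu.

Lemma energy_ge0 v : flux_ae_differentiable H v ->
  0 <= a_h f H v v + J_h f H nu v v.
Proof.
move=> aeH; rewrite (a_h_energy _ cf dg) (J_h_energy aeH).
have kN := cutidx_interior M.
have d0 := dissipation_ge0 H_consistent H_mono1 H_mono2 dg.
rewrite (bigD1_seq k.-1) ?iota_uniq ?mem_index_iota//=; last by lia.
have -> : trace_left v k.-1 = (piece v (Cell k.-1)).[edge M k.-1].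
  rewrite /trace_left gtn_eqF; last by lia.
  by rewrite left_cell_neq// ltn_eqF; last by lia.
have -> : trace_right v k.-1 = (piece v Cut1).[edge M k.-1].
  rewrite /trace_right ltn_eqF; last by lia.
  by rewrite /right_cell prednK ?eqxx; last by lia.
set D0 := dis _ _; set D1 := \sum_(_ <- _ | _) _.
set D2 := dis _ _; set D3 := dis _ _; set D4 := dis _ _; set D5 := dis _ _.
have e0 := eta_ge0; have e1 : 0 <= 1 - eta M nu by rewrite subr_ge0 eta_le1.
have L0 := Lcoef_ge0 v; have R0 := Rcoef_ge0 v.
have D1_ge0 : 0 <= D1 by exact: sumr_ge0.
have [D0_ge0 D2_ge0 D3_ge0] : [/\ 0 <= D0, 0 <= D2 & 0 <= D3] by split; exact: d0.
have [D4_ge0 D5_ge0] : 0 <= D4 /\ 0 <= D5 by split; exact: d0.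
clearbody D0 D1 D2 D3 D4 D5.
rewrite (_ : _ + _ = (1 - eta M nu) * D0 + D1 + D2 + (1 - eta M nu) * D3 +
  eta M nu * (Rcoef f v * D4) + eta M nu * (Lcoef f v * D5)); last by ring.
by rewrite !addr_ge0 ?mulr_ge0.
Qed.

End Stabilization.

(** * Quadratic forms along a differentiable curve *)

Section BilinearForms.
Context {R : realType} {m n : nat}.
Implicit Types v w : 'M[R]_(m, n).

Lemma coord_continuous_mx (i : 'I_m) (j : 'I_n) :
  continuous (fun v : 'M[R]_(m, n) => v i j).
Proof.
move=> v P nP.
(* A neighbourhood of a matrix is given by neighbourhoods of its entries. *)
exists (fun i' j' => if (i' == i) && (j' == j) then P else setT).
  move=> i' j'; case: ifP => [/andP[/eqP -> /eqP ->] //|_]; exact: filterT.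
by move=> w /(_ i j); rewrite !eqxx.
Qed.

Lemma continuous_coordM (i : 'I_m) (j : 'I_n) (c : 'M[R]_(m, n) -> R) :
  continuous c -> continuous (fun v : 'M[R]_(m, n) => v i j * c v).
Proof.
move=> cc w; apply: continuousM; [exact: coord_continuous_mx|exact: cc].
Qed.

Lemma is_derive_bigsum (I : Type) (s : seq I) (F : I -> R -> R) (dF : I -> R)
    (t : R) : (forall i, is_derive t 1 (F i) (dF i)) ->
  is_derive t 1 (fun x => \sum_(i <- s) F i x) (\sum_(i <- s) dF i).
Proof.
move=> dFi; elim: s => [|i s ih].
  rewrite big_nil (_ : (fun _ => _) = cst 0); first exact: is_derive_cst.
  by apply/funext => x; rewrite big_nil.
rewrite big_cons (_ : (fun _ => _) = F i \+ (fun x => \sum_(i <- s) F i x)).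
  exact: is_deriveD.
by apply/funext => x; rewrite big_cons.
Qed.

Lemma continuous_bigsum (T : topologicalType) (I : Type) (s : seq I)
    (F : I -> T -> R) : (forall i, continuous (F i)) ->
  continuous (fun x => \sum_(i <- s) F i x).
Proof.
move=> cF; elim: s => [|i s ih] x.
  by under eq_fun do rewrite big_nil; exact: cvg_cst.
under eq_fun do rewrite big_cons.
by apply: cvgD; [exact: cF|exact: ih].
Qed.

Lemma linear_form_coord (l : {scalar 'M[R]_(m, n)}) v :
  l v = \sum_i \sum_j v i j * l (delta_mx i j).
Proof.
rewrite {1}(matrix_sum_delta v) linear_sum; apply: eq_bigr => i _.
by rewrite linear_sum; apply: eq_bigr => j _; rewrite linearZ.
Qed.

Lemma is_derive_coord (u : R -> 'M[R]_(m, n)) (t : R) i j : derivable u t 1 ->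
  is_derive t 1 (fun s => u s i j) (derive1 u t i j).
Proof.
move=> du; have /derivable_mxP/(_ i j) dij := du.
by apply: DeriveDef; [exact: dij|rewrite derive1E derive_mx// mxE].
Qed.

Lemma is_derive_linear_form (l : {scalar 'M[R]_(m, n)}) (u : R -> 'M[R]_(m, n))
    (t : R) : derivable u t 1 -> is_derive t 1 (l \o u) (l (derive1 u t)).
Proof.
move=> du; rewrite (_ : l \o u = fun s => \sum_i \sum_j u s i j * l (delta_mx i j)).
  rewrite linear_form_coord; apply: is_derive_bigsum => i.
  apply: is_derive_bigsum => j; have dij := is_derive_coord i j du.
  have := is_deriveM dij (is_derive_cst (l (delta_mx i j)) t 1).
  by congr is_derive; rewrite /GRing.scale /=; ring.
by apply/funext => s /=; exact: linear_form_coord.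
Qed.

Lemma continuous_linear_form (l : {scalar 'M[R]_(m, n)}) : continuous l.
Proof.
rewrite (_ : (l : _ -> _) = fun v => \sum_i \sum_j v i j * l (delta_mx i j)).
  apply: continuous_bigsum => i; apply: continuous_bigsum => j.
  exact: (@continuous_coordM i j (cst (l (delta_mx i j))) (@cst_continuous _ _ _)).
by apply/funext => v; exact: linear_form_coord.
Qed.

Variable B : 'M[R]_(m, n) -> {scalar 'M[R]_(m, n)}.
Hypothesis B_sym : forall v w, B v w = B w v.

Lemma bilinear_form_coord v w :
  B v w = \sum_i \sum_j v i j * B (delta_mx i j) w.
Proof.
rewrite B_sym linear_form_coord; apply: eq_bigr => i _; apply: eq_bigr => j _.
by rewrite B_sym.
Qed.

(** The product rule in coordinates; symmetry merges the two halves. *)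
Lemma is_derive_quadratic_form (u : R -> 'M[R]_(m, n)) (t : R) :
  derivable u t 1 ->
  is_derive t 1 (fun s => B (u s) (u s)) (2 * B (derive1 u t) (u t)).
Proof.
move=> du; rewrite (_ : (fun _ => _) =
    fun s => \sum_i \sum_j u s i j * (B (delta_mx i j) \o u) s); last first.
  by apply/funext => s; exact: bilinear_form_coord.
rewrite mulr_natl mulr2n {1}B_sym !bilinear_form_coord -big_split /=.
apply: is_derive_bigsum => i; rewrite -big_split /=.
apply: is_derive_bigsum => j; have dij := is_derive_coord i j du.
have := is_deriveM dij (is_derive_linear_form (B (delta_mx i j)) du).
by congr is_derive; rewrite /GRing.scale /=; ring.
Qed.

Lemma continuous_quadratic_form : continuous (fun v => B v v).
Proof.
rewrite (_ : (fun _ => _) =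
    fun v => \sum_i \sum_j v i j * B (delta_mx i j) v); last first.
  by apply/funext => v; exact: bilinear_form_coord.
apply: continuous_bigsum => i; apply: continuous_bigsum => j.
exact: (@continuous_coordM i j _ (@continuous_linear_form (B (delta_mx i j)))).
Qed.

End BilinearForms.

(** * The L2 inner product of the discrete space *)

Section L2.
Context {R : realType}.
Variables (M : cut_mesh R) (p : nat).
Local Notation N := (ncells M).
Implicit Types v w z : 'M[R]_(N.+1, p.+1).
Notation mu := (@lebesgue_measure R).

Lemma measurable_cell_set (c : cell) : measurable (cell_set M c).
Proof. by case: c => *; exact: measurable_itv. Qed.

Lemma dgfun_linear v w (a x : R) :
  dgfun (a *: v + w) x = a * dgfun v x + dgfun w x.
Proof.
rewrite /dgfun mulr_sumr -big_split /=; apply: eq_bigr => c _.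
rewrite /piece !linearP hornerD hornerZ; ring.
Qed.

Lemma measurable_dgfun v : measurable_fun setT (dgfun v).
Proof.
apply: measurable_sum => c; apply: measurable_funM.
  by apply: measurable_indic; exact: measurable_cell_set.
by apply: continuous_measurable_fun; exact: continuous_horner.
Qed.

Lemma dgfun_bounded v : exists2 C, 0 <= C &
  forall x, Omega M x -> `|dgfun v x| <= C.
Proof.
have ab := ltW (xL_lt_xR M).
rewrite /dgfun; elim: (cells M) => [|c s [C C0 hC]].
  by exists 0 => // x _; rewrite big_nil normr0.
have [D D0 hD] := continuous_bounded_cc ab (@continuous_horner R (piece v c)).
exists (D + C); first exact: addr_ge0.
move=> x Ox; rewrite big_cons (le_trans (ler_normD _ _))// lerD ?hC//.
rewrite normrM indicE -[D]mul1r ler_pM//.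
  by case: (_ \in _); rewrite ?normr1 ?normr0.
by move: Ox; rewrite /Omega /= in_itv /= => /andP[? ?]; rewrite hD ?ltW.
Qed.

Lemma integrable_dgfunM v w :
  mu.-integrable (Omega M) (EFin \o (fun x => dgfun v x * dgfun w x)).
Proof.
apply: measurable_bounded_integrable.
- exact: measurable_itv.
- have := itvD_finite (xL M) (xR M) (@measurable0 _ R); rewrite setD0; exact.
- apply: (@measurable_funS _ _ _ _ setT) => //.
  by apply: measurable_funM; exact: measurable_dgfun.
- have [C C0 hC] := dgfun_bounded v; have [D D0 hD] := dgfun_bounded w.
  exists (C * D); split; first by rewrite num_real.
  move=> K hK x Ox; apply: le_trans (ltW hK).
  by rewrite /= normrM ler_pM ?hC ?hD.
Qed.

Lemma L2innerC v w : L2inner v w = L2inner w v.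
Proof. by apply: eq_Rintegral => x _; rewrite mulrC. Qed.

Lemma L2inner_scalar v : scalar (L2inner v).
Proof.
move=> a w z; rewrite /L2inner.
rewrite -RintegralZl//; [|exact: measurable_itv|exact: integrable_dgfunM].
rewrite -RintegralD//; [|exact: measurable_itv| |exact: integrable_dgfunM].
  by apply: eq_Rintegral => x _; rewrite dgfun_linear; ring.
(* A multiple of [w] is again a discrete function, which gives the
   integrability of the scaled integrand. *)
have := integrable_dgfunM v (a *: w).
rewrite (_ : (fun x => _) = fun x => a * (dgfun v x * dgfun w x))//.
apply/funext => x; have := dgfun_linear w 0 a x.
have d0 : dgfun (0 : 'M[R]_(N.+1, p.+1)) x = 0.
  by have := dgfun_linear 0 0 (-1) x; rewrite scaler0 addr0; lra.
by rewrite d0 !addr0 => ->; ring.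
Qed.

HB.instance Definition _ v :=
  GRing.isLinear.Build R 'M[R]_(N.+1, p.+1) R _ (L2inner v) (L2inner_scalar v).

Let B v : {scalar 'M[R]_(N.+1, p.+1)} := L2inner v.

Lemma is_derive_L2inner (u : R -> 'M[R]_(N.+1, p.+1)) (t : R) :
  derivable u t 1 ->
  is_derive t 1 (fun s => L2inner (u s) (u s)) (2 * L2inner (derive1 u t) (u t)).
Proof. exact: (@is_derive_quadratic_form _ _ _ B L2innerC). Qed.

Lemma continuous_L2inner : continuous (fun v => L2inner v v).
Proof. exact: (@continuous_quadratic_form _ _ _ B L2innerC). Qed.

End L2.

(** The product norm is the maximum of the two norms, hence at most their
    sum. *)
Lemma lipschitz_flux (R : realType) (H : R -> R -> R) :
  lipschitz (fun z : R * R => H z.1 z.2) ->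
  exists2 K, 0 <= K & flux_lipschitz H K.
Proof.
move=> /pinfty_ex_gt0[K K0 hK]; exists K; first exact: ltW.
move=> a a' b b'; have := hK ((a, b), (a', b')) (conj I I).
move=> /= /le_trans; apply; rewrite ler_pM2l// /Num.Def.normr /=.
by rewrite ge_max lerDl lerDr !normr_ge0.
Qed.

(** * Stability *)

Theorem theorem7 (R : realType) (M : cut_mesh R) (p : nat) (nu : R)
  (f : R -> R) (H : R -> R -> R) (T : R) (u : R -> dgspace M p)
  (nu_gt0 : 0 < nu)
  (H_consistent : forall s, H s s = f s)
  (H_lipschitz : lipschitz (fun z : R * R => H z.1 z.2))
  (H_monotone1 : forall b, {homo (fun a => H a b) : a a' / a <= a'})
  (H_monotone2 : forall a, {homo (fun b => H a b) : b b' / b <= b' >-> b' <= b})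
  (u_solution : DoD_solution f H nu T u)
  (H_ae_differentiable :
     forall t, 0 < t < T -> flux_ae_differentiable H (u t)) :
  forall t, 0 < t < T -> L2norm (u t) <= L2norm (u 0).
Proof.
move=> t /andP[t0 tT].
have [K K0 hK] := lipschitz_flux H_lipschitz.
have cf : continuous f.
  have -> : f = fun s => H s s by apply/funext => s; rewrite H_consistent.
  by apply: (@continuous_flux _ H K id id) => // s; exact: cvg_id.
have [g dg] := antiderivative cf.
have [cu du eqn] := u_solution.
rewrite /L2norm ler_wsqrtr//.
have dE s : s \in `]0, t[%R -> is_derive s 1 (fun s => L2inner (u s) (u s))
    (2 * L2inner (derive1 u s) (u s)).
  rewrite in_itv /= => /andP[s0 st]; apply: is_derive_L2inner; apply: du.
  by rewrite s0 (lt_trans st).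
have := @ler0_derive1_le_cc R (fun s => L2inner (u s) (u s)) 0 t.
apply; rewrite ?in_itv /= ?lexx ?(ltW t0)//.
- by move=> s /dE[].
- move=> s st; rewrite derive1E; have [_ ->] := dE s st.
  move: st; rewrite in_itv /= => /andP[s0 st].
  have sT : 0 < s < T by rewrite s0 (lt_trans st).
  have := energy_ge0 K0 hK cf dg H_consistent H_monotone1 H_monotone2 nu_gt0
    (H_ae_differentiable s sT).
  by have := eqn s sT (u s); lra.
- have {}cu : {within `[0, t], continuous u}.
    apply: continuous_subspaceW cu => s /=; rewrite !in_itv /= => /andP[-> st].
    exact: le_lt_trans st tT.
  by move=> s; apply: continuous_comp (cu s) (@continuous_L2inner _ M p (u s)).
Qed.
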